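(* Let $n,r$ be positive integers, $A\in\mathbb R^{n\times n}$, $U,V\in\mathbb R^{n\times r}$, $W\in\mathbb R^{r\times r}$, and $$K=\begin{pmatrix}W&V^T\\-U&A\end{pmatrix}.$$ Suppose that the matrices $A$, $W$ and $K$ are nonsingular. Write $S=A+UW^{-1}V^T$ and $R=I_r-V^TS^{-1}UW^{-1}$. Then $S$ is nonsingular, $S^{-1}$ is the trailing (southeastern) $n\times n$ block of $K^{-1}$, and $$A^{-1}=S^{-1}+S^{-1}UW^{-1}R^{-1}V^TS^{-1}$$ (in particular $R$ is nonsingular). *)

(* Defs.v *)
From mathcomp Require Export all_boot all_order all_algebra.
From mathcomp Require Export reals.
Set Implicit Arguments.
Unset Strict Implicit.
Unset Printing Implicit Defensive.

(* Main.v *)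
Require Import Defs.
From mathcomp Require Import all_boot all_order all_algebra.
From mathcomp Require Import reals.
Import Order.TTheory GRing.Theory Num.Theory.
Local Open Scope ring_scope.

(** Eliminating the upper right block of [K^-1] from the right block column of
    [K K^-1 = 1] shows that the trailing block of [K^-1] is a right inverse of
    [S].  With [D = U W^-1] we have [S = A + D V^T], hence
    [S^-1 D V^T A^-1 = A^-1 D V^T S^-1 = A^-1 - S^-1], from which
    [R^-1 = 1 + V^T A^-1 D] and the formula for [A^-1] follow by expansion. *)

Lemma mulmx1_invmx {F : comUnitRingType} {n : nat} {A B : 'M[F]_n} :
  A *m B = 1%:M -> invmx A = B.
Proof.
move=> AB1; have [uA _] := mulmx1_unit AB1.
by rewrite -[LHS]mulmx1 -AB1 mulKmx.
Qed.

Lemma schur_mul_drsubmx_inv {F : comUnitRingType} {r n : nat}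
    {W : 'M[F]_r} {B : 'M[F]_(r, n)} {C : 'M[F]_(n, r)} {A : 'M[F]_n} :
  W \in unitmx -> block_mx W B C A \in unitmx ->
  (A - C *m invmx W *m B) *m drsubmx (invmx (block_mx W B C A)) = 1%:M.
Proof.
move=> uW /mulmxV; set X := invmx _.
rewrite -[X]submxK mulmx_block scalar_mx_block.
case/eq_block_mx=> _ WB0 _ CA1; rewrite block_mxKdr.
(* [WB0] is solved for the upper right block; substituting it into [CA1] leaves the Schur complement
   of [W]. *)
have uX : ursubmx X = - (invmx W *m B *m drsubmx X).
  rewrite -[LHS](mulKmx uW) -mulmxA -mulmxN; congr (_ *m _).
  by apply/eqP; rewrite -addr_eq0 WB0.
by rewrite -CA1 uX mulmxBl mulmxN !mulmxA addrC.
Qed.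

Section Woodbury.
Context {F : comUnitRingType} {n r : nat}.
Context {A : 'M[F]_n} {D : 'M[F]_(n, r)} {E : 'M[F]_(r, n)}.
Hypotheses (uA : A \in unitmx) (uS : A + D *m E \in unitmx).
Let S := A + D *m E.

Let DE : D *m E = S - A. Proof. by rewrite /S addrC addKr. Qed.

(** Since [D *m E = S - A], this is the resolvent identity $S^{-1}(S-A)A^{-1}=A^{-1}-S^{-1}$. *)
Lemma invmx_subr : invmx S *m D *m E *m invmx A = invmx A - invmx S.
Proof.
by rewrite -(mulmxA _ D) DE mulmxBr mulVmx // mulmxBl mul1mx mulmxK.
Qed.

Lemma invmx_subl : invmx A *m D *m E *m invmx S = invmx A - invmx S.
Proof.
by rewrite -(mulmxA _ D) DE mulmxBr mulVmx // mulmxBl mul1mx mulmxK.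
Qed.

(** With $M=ES^{-1}D$ and $N=EA^{-1}D$, the resolvent identity gives $MN=N-M$, so $(1-M)(1+N)=1$. *)
Lemma woodbury_mul :
  (1%:M - E *m invmx S *m D) *m (1%:M + E *m invmx A *m D) = 1%:M.
Proof.
rewrite mulmxBl mul1mx mulmxDr mulmx1.
have -> : E *m invmx S *m D *m (E *m invmx A *m D)
    = E *m (invmx S *m D *m E *m invmx A) *m D by rewrite !mulmxA.
by rewrite invmx_subr mulmxBr mulmxBl [_ + (_ - _)]addrC subrK addrK.
Qed.

Lemma woodbury : invmx A = invmx S
  + invmx S *m D *m invmx (1%:M - E *m invmx S *m D) *m E *m invmx S.
Proof.
rewrite (mulmx1_invmx woodbury_mul).
(* Absorbing the inverse of $1-M$ turns $ES^{-1}$ into $EA^{-1}$, so the correction term becomes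
   $S^{-1}DEA^{-1}=A^{-1}-S^{-1}$. *)
have QE : (1%:M + E *m invmx A *m D) *m E *m invmx S = E *m invmx A.
  rewrite !mulmxDl mul1mx.
  have -> : E *m invmx A *m D *m E *m invmx S
      = E *m (invmx A *m D *m E *m invmx S) by rewrite !mulmxA.
  by rewrite invmx_subl mulmxBr addrC subrK.
rewrite -2!(mulmxA (invmx S *m D)) QE mulmxA invmx_subr.
by rewrite addrC subrK.
Qed.

End Woodbury.

Theorem theorem6p1 (F : realType) (n r : nat) (hn : (0 < n)%N) (hr : (0 < r)%N)
  (A : 'M[F]_n) (U V : 'M[F]_(n, r)) (W : 'M[F]_r) :
  let K : 'M[F]_(r + n) := block_mx W V^T (- U) A in
  A \in unitmx -> W \in unitmx -> K \in unitmx ->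
  let S : 'M[F]_n := A + U *m invmx W *m V^T in
  let R : 'M[F]_r := 1%:M - V^T *m invmx S *m U *m invmx W in
  [/\ S \in unitmx,
      invmx S = drsubmx (invmx K),
      R \in unitmx
    & invmx A = invmx S
        + invmx S *m U *m invmx W *m invmx R *m V^T *m invmx S].
Proof.
move=> K uA uW uK S R.
(* The block [- U] of [K] makes its Schur complement $A-(-U)W^{-1}V^T=S$. For square matrices this
   one-sided inverse already gives invertibility. *)
have SX1 : S *m drsubmx (invmx K) = 1%:M.
  by rewrite -(schur_mul_drsubmx_inv uW uK) !mulNmx opprK.
have [uS _] := mulmx1_unit SX1.
have defR : R = 1%:M - V^T *m invmx S *m (U *m invmx W) by rewrite /R !mulmxA.
split=> //; first exact: mulmx1_invmx.
- by have [] := mulmx1_unit (woodbury_mul uA uS); rewrite -/S -defR.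
- by rewrite (woodbury uA uS) -/S -defR !mulmxA.
Qed.
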